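(* Let $n\ge 0$ be an integer, let $r, w_1, w_2\in\mathbb{N}$, let $q\in\mathbb{C}_p$ with $q\neq 1$ and $|1-q|_p<p^{-1/(p-1)}$, and let $x\in\mathbb{C}_p$ with $|x|_p\le 1$. Then $$\sum_{i=0}^{n}\binom{n}{i}[w_1]_q^{n-i}[w_2]_q^{i-r}\beta_{i,q^{w_2}}^{(r)}(w_1x)\,T_{n,i}^{(r)}(w_2|q^{w_1})=\sum_{i=0}^{n}\binom{n}{i}[w_2]_q^{n-i}[w_1]_q^{i-r}\beta_{i,q^{w_1}}^{(r)}(w_2x)\,T_{n,i}^{(r)}(w_1|q^{w_2}),$$ where, for $w\in\mathbb{N}$ and $0\le i\le n$, $$T_{n,i}^{(r)}(w|Q)=\sum_{j_1,\dots,j_r=0}^{w-1}[j_1+\cdots+j_r]_Q^{n-i}\,Q^{(i+1)\sum_{l=1}^r j_l}.$$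
   Context: $p$ is a fixed prime; $\mathbb{C}_p$ is the completion of an algebraic closure of $\mathbb{Q}_p$, with absolute value normalized by $|p|_p=p^{-1}$. $\mathbb{N}=\{1,2,3,\dots\}$. For $Q\in\mathbb{C}_p$ with $Q\ne 1$, $|1-Q|_p<p^{-1/(p-1)}$ and $z\in\mathbb{C}_p$ with $|z|_p\le1$, put $Q^z=\exp(z\log Q)$ ($p$-adic exponential and logarithm) and $[z]_Q=\frac{1-Q^z}{1-Q}$. If $q$ satisfies $q\ne1$, $|1-q|_p<p^{-1/(p-1)}$, then so does $q^{w}$ for every $w\in\mathbb{N}$. The higher-order Carlitz $Q$-Bernoulli polynomials (order $r\in\mathbb{N}$, $n\ge0$) are $$\beta_{n,Q}^{(r)}(z)=\frac{1}{(1-Q)^n}\sum_{l=0}^{n}\binom{n}{l}(-1)^lQ^{lz}\left(\frac{l+1}{[l+1]_Q}\right)^r .$$ Convention: $a^0=1$ for all $a$, including $a=0$. *)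

(* Defs.v *)
From HB Require Import structures.
From mathcomp Require Import all_boot all_order all_algebra.
From mathcomp Require Import boolp classical_sets functions reals topology.
From mathcomp Require Import normedtype sequences exp.

Set Implicit Arguments.
Unset Strict Implicit.
Unset Printing Implicit Defensive.

Import Order.TTheory GRing.Theory Num.Theory.
Import numFieldNormedType.Exports.
Local Open Scope classical_set_scope.
Local Open Scope ring_scope.

Structure valuedField (R : realType) := ValuedField {
  vsort :> fieldType;
  vabs : vsort -> R;
  vabs_ge0 : forall x, 0 <= vabs x;
  vabs_eq0 : forall x, vabs x = 0 <-> x = 0;
  vabsM : forall x y, vabs (x * y) = vabs x * vabs y;
  vabs_ultra : forall x y, vabs (x + y) <= Num.max (vabs x) (vabs y)
}.

Section Convergence.
Variables (R : realType) (K : valuedField R).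
Implicit Types (u : nat -> K) (l : K).

Definition vcvg u l : Prop := (fun n => vabs (u n - l)) @ \oo --> (0 : R).

Definition vcauchy u : Prop :=
  forall e : R, 0 < e ->
    exists N : nat, forall m n : nat, (N <= m)%N -> (N <= n)%N ->
      vabs (u m - u n) < e.

Definition vcomplete : Prop := forall u, vcauchy u -> exists l, vcvg u l.

(* Junk value 0 when u does not converge. *)
Definition vlim u : K := xget 0 [set l | vcvg u l].

Definition vseries u : K := vlim (fun n => \sum_(0 <= k < n) u k).

End Convergence.

Definition is_completion (R : realType) (F : fieldType) (vF : F -> R)
    (K : valuedField R) (f : {rmorphism F -> K}) : Prop :=
  [/\ forall a, vabs (f a) = vF a,
      forall (x : K) (e : R), 0 < e -> exists a : F, vabs (x - f a) < e
    & vcomplete K].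

Definition is_algebraic_closure (F L : fieldType) (f : {rmorphism F -> L}) :
    Prop :=
  GRing.closed_field_axiom L /\ forall y : L, algebraicOver f y.

Definition padic_abs (R : realType) (p : nat) (a : rat) : R :=
  if a == 0 then 0
  else p%:R ^ ((logn p `|denq a|%N)%:Z - (logn p `|numq a|%N)%:Z).

(* C_p is determined only up to isometric isomorphism, so it is presented by
   the tower Q -> Q_p -> an algebraic closure of Q_p -> C_p.  The absolute value
   on the algebraic closure is the one extending that of Q_p. *)
Structure padicComplex (R : realType) (p : nat) := PadicComplex {
  Qp : valuedField R;
  Qpbar : valuedField R;
  Cp :> valuedField R;
  Qp_in : {rmorphism rat -> Qp};
  Qpbar_in : {rmorphism Qp -> Qpbar};
  Cp_in : {rmorphism Qpbar -> Cp};
  Qp_completion : is_completion (@padic_abs R p) Qp_in;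
  Qpbar_closure : is_algebraic_closure Qpbar_in;
  Qpbar_abs : forall a : Qp, vabs (Qpbar_in a) = vabs a;
  Cp_completion : is_completion (@vabs R Qpbar) Cp_in
}.

Section Carlitz.
Variables (R : realType) (K : valuedField R).
Implicit Types (Q x z : K) (n i r w : nat).

Definition pexp x : K := vseries (fun k => x ^+ k / k`!%:R).

Definition plog x : K :=
  vseries (fun k => (-1) ^+ k * (x - 1) ^+ k.+1 / k.+1%:R).

Definition qpow Q z : K := pexp (z * plog Q).

Definition qnum Q z : K := (1 - qpow Q z) / (1 - Q).

Definition carlitz_beta r n Q z : K :=
  1 / (1 - Q) ^+ n *
  \sum_(l < n.+1)
    'C(n, l)%:R * (-1) ^+ l * qpow Q (l%:R * z) *
    (l.+1%:R / qnum Q l.+1%:R) ^+ r.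

Definition carlitz_T r n i w Q : K :=
  \sum_(j : {ffun 'I_r -> 'I_w})
    qnum Q (\sum_(l < r) j l)%N%:R ^+ (n - i) *
    qpow Q (i.+1 * \sum_(l < r) j l)%N%:R.

End Carlitz.

(* Main.v *)
Require Import Defs.
From mathcomp Require Import all_boot all_order all_algebra.
From mathcomp Require Import classical_sets reals topology normedtype.
From mathcomp Require Import sequences exp.
From mathcomp Require Import ring.

(** Put e = q^1 = exp(log q) and X = q^(w1 w2 x).  On the disk
    |1 - q| < p^(-1/(p-1)) the powers obey the usual laws: q^(a+b) = q^a q^b,
    and (q^a)^b = q^(ab).  So every quantity in the identity is a rational
    function of e, X and 1 - q, and the left side becomes a sum over i, over
    l <= i (the sum defining the Bernoulli polynomial) and over the r-tuples j.
    With u = e^(w1 |j|), |j| = j_1 + ... + j_r, the only factors that involve i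
    are
      C(n,i) C(i,l) (1-u)^(n-i) u^i,
    whose sum over i is C(n,l) u^l ([sum_binomial_binomial], the coefficients
    of X^l in ((1-u) + u(1+X))^n = (1+uX)^n).  What remains of the sum over j
    is the r-th power of a geometric sum, so the left side equals
      (1-q)^(r-n) sum_l C(n,l) (-X)^l
        ( (l+1) (1-e^(w1 w2 (l+1)))
          / ((1-e^(w1 (l+1))) (1-e^(w2 (l+1)))) )^r
    ([carlitz_reduction], [carlitz_side_eval]).  This is symmetric in w1 and w2.

    The analytic input is the additivity of exp ([pexpD]), the identity
    log (exp y) = y ([plog_pexp]) and log q <> 0 ([plog_neq0]), which keeps the
    denominators 1 - e^k away from 0.  All of it rests on one estimate:
    |t^(k+1) / (k+1)!| <= |t| (|t| / rho)^k for rho = p^(-1/(p-1)), which holds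
    because v_p((k+1)!) <= k/(p-1).  Substituting one series into the other is
    avoided: log Q and (Q^N - 1)/N differ by at most |N| |Q - 1|
    ([plog_quotient]), while (exp(Ny) - 1)/N and y differ by at most |N| |y|
    ([pexp_quotient]).  As exp(Ny) = (exp y)^N, letting N run through the
    powers of p gives log (exp y) = y. *)

Set Implicit Arguments.
Unset Strict Implicit.
Unset Printing Implicit Defensive.

Import Order.TTheory GRing.Theory Num.Theory.
Import numFieldNormedType.Exports.
Local Open Scope classical_set_scope.
Local Open Scope ring_scope.

(** * Ultrametric fields: estimates, limits and series *)

Section Ultrametric.
Variables (R : realType) (K : valuedField R).
Implicit Types (x y t l m : K) (u v : nat -> K) (e M : R).

Lemma vabs0 : vabs (0 : K) = 0.
Proof. exact/vabs_eq0. Qed.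

Lemma vabs_gt0 x : x != 0 -> 0 < vabs x.
Proof.
move=> x0; rewrite lt_def vabs_ge0 andbT.
by apply: contra x0 => /eqP /vabs_eq0 ->.
Qed.

Lemma vabs1 : vabs (1 : K) = 1.
Proof.
have h : vabs (1 : K) != 0 by rewrite gt_eqF ?vabs_gt0 ?oner_neq0.
by apply: (mulfI h); rewrite -vabsM !mulr1.
Qed.

(** |-1| is a nonnegative real number with square |1| = 1. *)
Lemma vabsN x : vabs (- x) = vabs x.
Proof.
suff h : vabs (-1 : K) = 1 by rewrite -mulN1r vabsM h mul1r.
apply/eqP; rewrite -(@eqrXn2 _ 2) ?vabs_ge0 ?ler01 //.
by rewrite expr1n expr2 -vabsM mulrNN mulr1 vabs1.
Qed.

Lemma vabs_subC x y : vabs (x - y) = vabs (y - x).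
Proof. by rewrite -vabsN opprB. Qed.

Lemma vabsX x n : vabs (x ^+ n) = vabs x ^+ n.
Proof. by elim: n => [|n IHn]; rewrite ?expr0 ?vabs1 // !exprS vabsM IHn. Qed.

Lemma vabsV x : vabs x^-1 = (vabs x)^-1.
Proof.
have [->|x0] := eqVneq x 0; first by rewrite invr0 vabs0 invr0.
have h : vabs x != 0 by rewrite gt_eqF ?vabs_gt0.
by apply: (mulfI h); rewrite -vabsM !divff // vabs1.
Qed.

Lemma vabs_add_le M x y : vabs x <= M -> vabs y <= M -> vabs (x + y) <= M.
Proof.
by move=> hx hy; apply: le_trans (vabs_ultra x y) _; rewrite ge_max hx hy.
Qed.

Lemma vabs_add_lt M x y : vabs x < M -> vabs y < M -> vabs (x + y) < M.
Proof.
by move=> hx hy; apply: le_lt_trans (vabs_ultra x y) _; rewrite gt_max hx hy.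
Qed.

Lemma vabs_natr_le1 n : vabs (n%:R : K) <= 1.
Proof.
elim: n => [|n IHn]; first by rewrite vabs0 ler01.
by rewrite mulrSr vabs_add_le // vabs1.
Qed.

Lemma vabs_sum_le (I : Type) (s : seq I) (P : pred I) (F : I -> K) M :
  0 <= M -> (forall i, P i -> vabs (F i) <= M) ->
  vabs (\sum_(i <- s | P i) F i) <= M.
Proof.
move=> M0 hF; apply: (big_ind (fun x => vabs x <= M)) => //.
  by rewrite vabs0.
by move=> x y; apply: vabs_add_le.
Qed.

Lemma vcvgP u l :
  vcvg u l <->
  forall e, 0 < e -> exists N, forall n, (N <= n)%N -> vabs (u n - l) < e.
Proof.
rewrite /vcvg cvgr0Pnorm_lt; split=> h e e0.
  case: (h e e0) => N _ hN; exists N => n /hN.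
  by rewrite /= ger0_norm ?vabs_ge0.
case: (h e e0) => N hN; exists N => // n /hN.
by rewrite /= ger0_norm ?vabs_ge0.
Qed.

Lemma vcvg_squeeze u l (g : nat -> R) :
  (forall n, vabs (u n - l) <= g n) -> g @ \oo --> 0 -> vcvg u l.
Proof.
move=> hg g0; apply: (squeeze_cvgr _ (cvg_cst 0) g0).
by near=> n; rewrite vabs_ge0 hg.
Unshelve. all: by end_near.
Qed.

Lemma vcvg_dist_le u l t M :
  (exists N, forall n, (N <= n)%N -> vabs (u n - t) <= M) ->
  vcvg u l -> vabs (l - t) <= M.
Proof.
move=> [N hN] /vcvgP hl; rewrite leNgt; apply/negP => hM.
have M0 : 0 <= M by apply: le_trans (hN N (leqnn N)); apply: vabs_ge0.
have [N' hN'] := hl _ (le_lt_trans M0 hM).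
have := hN' _ (leq_maxr N N'); rewrite vabs_subC => h1.
have h2 := le_lt_trans (hN _ (leq_maxl N N')) hM.
by have := vabs_add_lt h1 h2; rewrite addrA subrK ltxx.
Qed.

Lemma vcvg_unique u l m : vcvg u l -> vcvg u m -> l = m.
Proof.
move=> hl /vcvgP hm; apply/eqP; rewrite -subr_eq0; apply/eqP/vabs_eq0/eqP.
rewrite eq_le vabs_ge0 andbT; apply/ler_addgt0Pl => e e0; rewrite addr0.
have [N hN] := hm e e0.
by apply: vcvg_dist_le hl; exists N => n /hN /ltW.
Qed.

Lemma vlimE u l : vcvg u l -> vlim u = l.
Proof.
move=> hl; rewrite /vlim; case: xgetP => [x _ /= hx|/(_ l)/=].
  exact: vcvg_unique hx hl.
by [].
Qed.

Lemma vcvgM u v l m :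
  vcvg u l -> vcvg v m -> vcvg (fun n => u n * v n) (l * m).
Proof.
move=> hu hv.
pose g n := (vabs (u n - l) + vabs l) * vabs (v n - m)
  + vabs (u n - l) * vabs m.
apply: (@vcvg_squeeze _ _ g) => [n|].
  have -> : u n * v n - l * m = (u n - l) * (v n - m) + l * (v n - m)
                                + (u n - l) * m by ring.
  rewrite /g [X in _ <= X + _]mulrDl -!vabsM; apply: vabs_add_le; last first.
    by rewrite lerDr addr_ge0 ?vabs_ge0.
  apply: vabs_add_le; first by rewrite -addrA lerDl addr_ge0 ?vabs_ge0.
  by rewrite -addrA addrCA lerDl addr_ge0 ?vabs_ge0.
have -> : (0 : R) = (0 + vabs l) * 0 + 0 * vabs m by rewrite mulr0 mul0r addr0.
apply: cvgD; apply: cvgM => //; last exact: cvg_cst.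
by apply: cvgD => //; exact: cvg_cst.
Qed.

(** In an ultrametric field a series converges as soon as its terms tend to 0:
    a block of terms is bounded by its largest one. *)
Lemma vseries_cvg u : vcomplete K -> vcvg u 0 ->
  vcvg (fun n => \sum_(0 <= k < n) u k) (vseries u).
Proof.
move=> Kc /vcvgP u0.
suff /Kc [l hl] : vcauchy (fun n => \sum_(0 <= k < n) u k).
  by rewrite /vseries (vlimE hl).
move=> e e0; have [N hN] := u0 _ (divr_gt0 e0 (ltr0n R 2)).
exists N => m n Nm Nn.
wlog mn : m n Nm Nn / (m <= n)%N.
  move=> H; case: (leqP m n) => [|/ltnW] mn; first exact: H.
  by rewrite vabs_subC; apply: H.
rewrite vabs_subC (big_cat_nat (leq0n m) mn) //= addrAC subrr add0r.
rewrite big_nat_cond.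
apply: (@le_lt_trans _ _ (e / 2)); last first.
  by rewrite ltr_pdivrMr ?ltr0n // mulr_natr mulr2n ltrDl.
apply: vabs_sum_le => [|i /andP[/andP[mi _] _]].
  by rewrite divr_ge0 ?ltW.
by have := hN i (leq_trans Nm mi); rewrite subr0 => /ltW.
Qed.

End Ultrametric.

(** * Exponential and logarithm on a disk *)

Section ExpLog.
Variables (R : realType) (K : valuedField R) (rho : R).
Hypothesis K_complete : vcomplete K.
Hypothesis rho_gt0 : 0 < rho.
(* For the residue characteristic p this holds with rho = p^(-1/(p-1)). *)
Hypothesis rho_fact : forall k, rho ^+ k <= vabs (k.+1`!%:R : K).
Hypothesis small_nat :
  forall e : R, 0 < e -> exists2 N : nat, (0 < N)%N & vabs (N%:R : K) < e.
Implicit Types (a b q t y z : K) (k n N : nat).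

Let ratio t : R := vabs t / rho.

(** The lower bound on |(k+1)!| forces characteristic 0. *)
Lemma natr_neq0 n : (0 < n)%N -> n%:R != 0 :> K.
Proof.
case: n => // n _; apply/negP => /eqP n0.
have := lt_le_trans (exprn_gt0 n rho_gt0) (rho_fact n).
by rewrite factS natrM n0 mul0r vabs0 ltxx.
Qed.

Lemma rho_le1 : rho <= 1.
Proof. exact: le_trans (rho_fact 1) (vabs_natr_le1 _ _). Qed.

Lemma ratio_ge0 t : 0 <= ratio t.
Proof. by rewrite divr_ge0 ?vabs_ge0 ?ltW. Qed.

Lemma ratio_lt1 t : vabs t < rho -> ratio t < 1.
Proof. by move=> ht; rewrite /ratio ltr_pdivrMr // mul1r. Qed.

Lemma vabs_le_ratio t : vabs t <= ratio t.
Proof. by rewrite ler_pdivlMr // ler_piMr ?vabs_ge0 ?rho_le1. Qed.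

(** The geometric decay behind every convergence statement on the disk; the
    factor |t| is kept apart because the comparisons below need it. *)
Lemma fact_term_le t k :
  vabs (t ^+ k.+1 / k.+1`!%:R) <= vabs t * ratio t ^+ k.
Proof.
rewrite vabsM vabsX vabsV exprS -mulrA expr_div_n.
rewrite !ler_wpM2l ?exprn_ge0 ?vabs_ge0 //.
by rewrite lef_pV2 ?posrE ?exprn_gt0 ?vabs_gt0 ?natr_neq0 ?fact_gt0.
Qed.

Lemma fact_term_le_ratio t k : vabs (t ^+ k / k`!%:R) <= ratio t ^+ k.
Proof.
case: k => [|k]; first by rewrite !expr0 divr1 vabs1.
apply: le_trans (fact_term_le t k) _.
by rewrite exprS ler_wpM2r ?exprn_ge0 ?ratio_ge0 ?vabs_le_ratio.
Qed.

Lemma fact_term_le_arg t k :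
  vabs t < rho -> vabs (t ^+ k.+1 / k.+1`!%:R) <= vabs t.
Proof.
move=> ht; apply: le_trans (fact_term_le t k) _.
by rewrite ler_piMr ?vabs_ge0 ?exprn_ile1 ?ratio_ge0 // ltW ?ratio_lt1.
Qed.

Lemma log_term_le t k :
  vabs (t ^+ k.+1 / k.+1%:R) <= vabs t * ratio t ^+ k.
Proof.
apply: le_trans (fact_term_le t k).
rewrite !vabsM ler_wpM2l ?vabs_ge0 // !vabsV.
rewrite lef_pV2 ?posrE ?vabs_gt0 ?natr_neq0 ?fact_gt0 //.
by rewrite factS natrM vabsM ler_piMr ?vabs_ge0 ?vabs_natr_le1.
Qed.

Lemma ratio_cvg0 t : vabs t < rho -> (fun n => ratio t ^+ n) @ \oo --> (0 : R).
Proof.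
by move=> ht; apply: cvg_expr; rewrite ger0_norm ?ratio_ge0 ?ratio_lt1.
Qed.

Lemma pexp_cvg t : vabs t < rho ->
  vcvg (fun n => \sum_(0 <= k < n) t ^+ k / k`!%:R) (pexp t).
Proof.
move=> ht; apply: vseries_cvg => //.
apply: vcvg_squeeze (ratio_cvg0 ht) => n.
by rewrite subr0 fact_term_le_ratio.
Qed.

Lemma plog_cvg q : vabs (q - 1) < rho ->
  vcvg (fun n => \sum_(0 <= k < n) (-1) ^+ k * (q - 1) ^+ k.+1 / k.+1%:R)
       (plog q).
Proof.
move=> hq; apply: vseries_cvg => //.
apply: vcvg_squeeze (ratio_cvg0 hq) => n.
rewrite subr0 -mulrA vabsM vabsX vabsN vabs1 expr1n mul1r.
apply: le_trans (log_term_le _ _) _.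
rewrite ler_piMl ?exprn_ge0 ?ratio_ge0 // ltW //.
exact: lt_le_trans hq rho_le1.
Qed.

(** Cauchy product.  Truncate both series to polynomials A, B of size n and
    compare values at 1: the coefficients of A B of index < n are the terms of
    the series at a + b, and those of index k >= n are at most c^k <= c^n, where
    c < 1 is the larger of the two ratios. *)
Lemma pexpD a b : vabs a < rho -> vabs b < rho ->
  pexp (a + b) = pexp a * pexp b.
Proof.
move=> ha hb; pose c := Num.max (ratio a) (ratio b).
have c0 : 0 <= c by rewrite le_max ratio_ge0.
have c1 : c < 1 by rewrite gt_max !ratio_lt1.
have hab : vabs (a + b) < rho by apply: vabs_add_lt.
apply: vcvg_unique (pexp_cvg hab) _; apply/vcvgP => e e0.
have /vcvgP/(_ e e0)[N1 hN1] := vcvgM (pexp_cvg ha) (pexp_cvg hb).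
have /cvgr0Pnorm_lt/(_ e e0)[N2 _ hN2] : (fun n => c ^+ n) @ \oo --> (0 : R).
  by apply: cvg_expr; rewrite ger0_norm.
exists (maxn N1 N2) => n; rewrite geq_max => /andP[/hN1 h1 /hN2 /=].
rewrite normrX ger0_norm // => h2.
set S := \sum_(0 <= k < n) _; set P := _ * _ in h1.
suff h : vabs (S - P) <= c ^+ n.
  rewrite -(subrK P S) -addrA; apply: vabs_add_lt => //.
  exact: le_lt_trans h h2.
pose A t := \poly_(i < n) (t ^+ i / i`!%:R).
have coefA t i : vabs t < rho -> ratio t <= c -> vabs (A t)`_i <= c ^+ i.
  move=> ht tc; rewrite coef_poly; case: ifP => _.
    apply: le_trans (fact_term_le_ratio t i) _.
    by rewrite lerXn2r ?nnegrE ?ratio_ge0.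
  by rewrite vabs0 exprn_ge0.
have A1 t : (A t).[1] = \sum_(0 <= k < n) t ^+ k / k`!%:R.
  rewrite (horner_coef_wide _ (size_poly _ _)) big_mkord.
  by apply: eq_bigr => i _; rewrite expr1n mulr1 coef_poly ltn_ord.
have sAB : (size (A a * A b)%R <= n + n)%N.
  apply: leq_trans (size_polyMleq _ _) _; apply: leq_trans (leq_pred _) _.
  by rewrite leq_add ?size_poly.
have -> : P = \sum_(0 <= k < n + n) (A a * A b)`_k.
  rewrite /P -!A1 -hornerM (horner_coef_wide _ sAB) big_mkord.
  by apply: eq_bigr => i _; rewrite expr1n mulr1.
rewrite (big_cat_nat (leq0n n) (leq_addr n n)) /=.
have -> : \sum_(0 <= k < n) (A a * A b)`_k = S.
  apply: eq_big_nat => k /andP[_ kn]; rewrite coefM addrC exprDn mulr_suml.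
  apply: eq_bigr => i _; rewrite !coef_poly.
  have ik : (i <= k)%N by rewrite -ltnS.
  rewrite (leq_ltn_trans ik kn) (leq_ltn_trans (leq_subr i k) kn).
  have f0 m : m`!%:R != 0 :> K by rewrite natr_neq0 ?fact_gt0.
  have e1 : k`!%:R = 'C(k, i)%:R * (i`!%:R * (k - i)`!%:R) :> K.
    by rewrite -!natrM bin_fact.
  have C0 : 'C(k, i)%:R != 0 :> K by rewrite natr_neq0 ?bin_gt0.
  by rewrite e1 -mulr_natl; field; rewrite C0 !f0.
rewrite opprD addNKr vabsN big_nat_cond.
apply: vabs_sum_le => [|k /andP[/andP[nk _] _]]; first by rewrite exprn_ge0.
apply: (@le_trans _ _ (c ^+ k)); last by rewrite ler_wiXn2l // ltW.
rewrite coefM; apply: vabs_sum_le => [|i _]; first by rewrite exprn_ge0.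
have ik : (i <= k)%N by rewrite -ltnS.
rewrite -[in leRHS](subnKC ik) exprD vabsM.
by apply: ler_pM; rewrite ?vabs_ge0 //; apply: coefA;
  rewrite // le_max lexx ?orbT.
Qed.

(** Every term of the logarithm after the first is smaller than the first by
    the factor |q - 1| / rho at least. *)
Lemma plog_near q : vabs (q - 1) < rho ->
  vabs (plog q - (q - 1)) <= vabs (q - 1) * ratio (q - 1).
Proof.
move=> hq; apply: vcvg_dist_le (plog_cvg hq); exists 1%N => n n0.
rewrite big_ltn // expr0 mul1r expr1 divr1 addrAC subrr add0r big_nat_cond.
apply: vabs_sum_le => [|k /andP[/andP[k0 _] _]].
  by rewrite mulr_ge0 ?vabs_ge0 ?ratio_ge0.
rewrite -mulrA vabsM vabsX vabsN vabs1 expr1n mul1r.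
apply: le_trans (log_term_le _ _) _.
rewrite ler_wpM2l ?vabs_ge0 // -[leRHS]expr1.
by rewrite ler_wiXn2l ?ratio_ge0 // ltW ?ratio_lt1.
Qed.

Lemma vabs_plog_le q : vabs (q - 1) < rho -> vabs (plog q) <= vabs (q - 1).
Proof.
move=> hq; rewrite -(subrK (q - 1) (plog q)); apply: vabs_add_le => //.
apply: le_trans (plog_near hq) _.
by rewrite ler_piMr ?vabs_ge0 // ltW ?ratio_lt1.
Qed.

Lemma plog_neq0 q : vabs (q - 1) < rho -> q != 1 -> plog q != 0.
Proof.
move=> hq q1; apply/eqP => y0; have := plog_near hq.
rewrite y0 sub0r vabsN leNgt => /negP; apply.
by rewrite -[ltRHS]mulr1 ltr_pM2l ?ratio_lt1 // vabs_gt0 // subr_eq0.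
Qed.

(** Modulo N, the product (N-1)(N-2)...(N-k) is (-1)^k k!.  The induction runs
    over all k, as both sides of the recurrence vanish once k >= N. *)
Lemma ffact_near N k : (0 < N)%N ->
  vabs ((N.-1 ^_ k)%:R - (-1) ^+ k * k`!%:R : K) <= vabs (N%:R : K).
Proof.
case: N => // N _ /=; elim: k => [|k IHk].
  by rewrite ffactn0 expr0 mul1r subrr vabs0 vabs_ge0.
have -> : (N ^_ k.+1)%:R = (N ^_ k)%:R * (N.+1%:R - k.+1%:R) :> K.
  rewrite ffactnSr natrM.
  have [kN|Nk] := leqP k N; last by rewrite ffact_small // !mul0r.
  by rewrite natrB // -(natr1 N) -(natr1 k); ring.
have -> : (N ^_ k)%:R * (N.+1%:R - k.+1%:R) - (-1) ^+ k.+1 * k.+1`!%:R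
  = (N ^_ k)%:R * N.+1%:R
    + - k.+1%:R * ((N ^_ k)%:R - (-1) ^+ k * k`!%:R) :> K.
  by rewrite exprS factS natrM; ring.
apply: vabs_add_le; rewrite vabsM.
  by rewrite ler_piMl ?vabs_ge0 ?vabs_natr_le1.
apply: le_trans IHk; rewrite ler_piMl ?vabs_ge0 // vabsN.
exact: vabs_natr_le1.
Qed.

(** By C(N,k+1) / N = C(N-1,k) / (k+1), the binomial expansion of (q^N - 1)/N is
    the logarithm series with (-1)^k replaced by C(N-1,k).  The error made there
    is at most |N| / |k!| by [ffact_near], and 1/k! combines with 1/(k+1) to the
    factor 1/(k+1)! controlled by [fact_term_le]. *)
Lemma plog_quotient q N : vabs (q - 1) < rho -> (0 < N)%N ->
  vabs (plog q - (q ^+ N - 1) / N%:R) <= vabs (N%:R : K) * vabs (q - 1).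
Proof.
move=> hq N0; apply: vcvg_dist_le (plog_cvg hq); exists N => n Nn.
set t := q - 1.
have -> : (q ^+ N - 1) / N%:R
    = \sum_(0 <= k < n) 'C(N.-1, k)%:R * t ^+ k.+1 / k.+1%:R.
  rewrite (big_cat_nat (leq0n N) Nn) /= [X in _ = _ + X]big_nat_cond.
  rewrite [X in _ = _ + X]big1 ?addr0 => [|k /andP[/andP[Nk _] _]]; last first.
    by rewrite bin_small ?mul0r //; case: N N0 Nk {Nn}.
  have -> : q = t + 1 by rewrite subrK.
  rewrite exprD1n big_ord_recl bin0 expr0 addrAC subrr add0r mulr_suml.
  rewrite big_mkord; apply: eq_bigr => i _; rewrite /= /bump /= add1n.
  have /(congr1 (fun m => m%:R : K)) := mul_bin_diag N i.
  rewrite !natrM => e1; have N1 := natr_neq0 N0.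
  have i1 := natr_neq0 (ltn0Sn i).
  rewrite -mulr_natl (_ : 'C(N, i.+1)%:R = N%:R * 'C(N.-1, i)%:R / i.+1%:R).
    by field; rewrite N1 nat1r i1.
  by rewrite e1 mulrAC divff // mul1r.
rewrite -sumrB; apply: vabs_sum_le => [|k _].
  by rewrite mulr_ge0 ?vabs_ge0.
have f0 : k`!%:R != 0 :> K by rewrite natr_neq0 ?fact_gt0.
have k0 : k.+1%:R != 0 :> K by rewrite natr_neq0.
have -> : (-1) ^+ k * t ^+ k.+1 / k.+1%:R - 'C(N.-1, k)%:R * t ^+ k.+1 / k.+1%:R
  = - (((N.-1 ^_ k)%:R - (-1) ^+ k * k`!%:R) * (t ^+ k.+1 / k.+1`!%:R)).
  rewrite -bin_ffact factS !natrM; field.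
  by rewrite f0 nat1r k0.
rewrite vabsN vabsM ler_pM ?vabs_ge0 ?ffact_near //.
exact: fact_term_le_arg.
Qed.

Lemma disk_natM n y : vabs y < rho -> vabs (n%:R * y) < rho.
Proof.
apply: le_lt_trans; rewrite vabsM.
by rewrite ler_piMl ?vabs_ge0 ?vabs_natr_le1.
Qed.

(** The terms of index k >= 2 of exp(Ny) carry the factor N^k, hence N^2, of
    which the division by N leaves one factor. *)
Lemma pexp_quotient y N : vabs y < rho -> (0 < N)%N ->
  vabs ((pexp (N%:R * y) - 1) / N%:R - y) <= vabs (N%:R : K) * vabs y.
Proof.
move=> hy N0; have N1 := natr_neq0 N0; set z := N%:R * y.
have -> : (pexp z - 1) / N%:R - y = (pexp z - (1 + z)) / N%:R.
  by rewrite /z; field.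
rewrite vabsM vabsV ler_pdivrMr ?vabs_gt0 //.
apply: vcvg_dist_le (pexp_cvg (disk_natM N hy)); exists 2%N => n n2.
rewrite (big_cat_nat (leq0n 2) n2) /= big_nat_recr //= big_nat1.
rewrite expr0 expr1 !divr1 addrAC subrr add0r big_nat_cond.
apply: vabs_sum_le => [|k /andP[/andP[k2 _] _]].
  by rewrite !mulr_ge0 ?vabs_ge0.
case: k k2 => [|[|k]] // _; rewrite exprMn -mulrA vabsM.
rewrite [leRHS]mulrAC; apply: ler_pM; rewrite ?vabs_ge0 ?fact_term_le_arg //.
rewrite vabsX exprSr exprSr -mulrA.
by rewrite ler_piMl ?mulr_ge0 ?vabs_ge0 // exprn_ile1 ?vabs_ge0 ?vabs_natr_le1.
Qed.

Lemma vabs_pexp_sub1_le y : vabs y < rho -> vabs (pexp y - 1) <= vabs y.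
Proof.
move=> hy; rewrite -(subrK y (pexp y - 1)); apply: vabs_add_le => //.
by have := @pexp_quotient _ 1 hy isT; rewrite mul1r divr1 vabs1 mul1r.
Qed.

Lemma pexp0 : pexp (0 : K) = 1.
Proof.
apply/eqP; rewrite -subr_eq0; apply/eqP/vabs_eq0/le_anti.
by rewrite vabs_ge0 -(vabs0 K) vabs_pexp_sub1_le // vabs0.
Qed.

Lemma pexp_natM n y : vabs y < rho -> pexp (n%:R * y) = pexp y ^+ n.
Proof.
move=> hy; elim: n => [|n IHn]; first by rewrite mul0r pexp0.
by rewrite -natr1 mulrDl mul1r exprSr -IHn pexpD // disk_natM.
Qed.

(** Both log (exp y) and y are within |N| of the common value
    (exp(Ny) - 1)/N = ((exp y)^N - 1)/N, and |N| is arbitrarily small. *)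
Lemma plog_pexp y : vabs y < rho -> plog (pexp y) = y.
Proof.
move=> hy; apply/eqP; rewrite -subr_eq0; apply/eqP/vabs_eq0/le_anti.
rewrite vabs_ge0 andbT; apply/ler_addgt0Pl => e e0; rewrite addr0.
have [N N0 hN] := small_nat e0; apply/ltW/(le_lt_trans _ hN).
have hE := vabs_pexp_sub1_le hy.
have hq : vabs (pexp y - 1) < rho by apply: le_lt_trans hE hy.
rewrite -(subrK ((pexp y ^+ N - 1) / N%:R) (plog _)) -addrA.
apply: vabs_add_le.
  apply: le_trans (plog_quotient hq N0) _; rewrite ler_piMr ?vabs_ge0 //.
  exact: ltW (lt_le_trans hq rho_le1).
rewrite -pexp_natM //; apply: le_trans (pexp_quotient hy N0) _.
rewrite ler_piMr ?vabs_ge0 //; exact: ltW (lt_le_trans hy rho_le1).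
Qed.

Section Power.
Variable q : K.
Hypothesis q_near1 : vabs (q - 1) < rho.

Lemma disk_qpow z : vabs z <= 1 -> vabs (z * plog q) < rho.
Proof.
move=> hz; apply: le_lt_trans q_near1.
apply: le_trans (vabs_plog_le q_near1); rewrite vabsM.
by rewrite ler_piMl ?vabs_ge0.
Qed.

Lemma qpow_natM n z : vabs z <= 1 -> qpow q (n%:R * z) = qpow q z ^+ n.
Proof. by move=> hz; rewrite /qpow -mulrA pexp_natM ?disk_qpow. Qed.

Lemma qpow_nat n : qpow q n%:R = qpow q 1 ^+ n.
Proof. by rewrite -[n%:R]mulr1 qpow_natM // vabs1. Qed.

Lemma qpow_qpow a b : vabs a <= 1 -> qpow (qpow q a) b = qpow q (a * b).
Proof.
by move=> ha; rewrite {1}/qpow plog_pexp ?disk_qpow // /qpow mulrA (mulrC b).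
Qed.

(** Otherwise n log q would be log 1 = 0. *)
Lemma qpow_nat_neq1 n : q != 1 -> (0 < n)%N -> qpow q 1 ^+ n != 1.
Proof.
move=> q1 n0; rewrite -qpow_nat /qpow.
have hd := disk_qpow (vabs_natr_le1 K n).
apply: contraNneq (mulf_neq0 (natr_neq0 n0) (plog_neq0 q_near1 q1)) => e1.
have plog1 : plog (1 : K) = 0 by rewrite -pexp0 plog_pexp // vabs0.
by rewrite -(plog_pexp hd) e1 plog1.
Qed.

End Power.
End ExpLog.

(** * The disk of convergence in the p-adic complex numbers *)

Section PadicConstants.
Variables (R : realType) (p : nat).
Hypothesis p_prime : prime p.

(** The multiples of p among 1, ..., n are p, 2p, ..., (n/p) p. *)
Lemma logn_fact_quotient n : logn p n`! = (n %/ p + logn p (n %/ p)`!)%N.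
Proof.
have p1 := prime_gt1 p_prime; have p0 := prime_gt0 p_prime.
have small m k : (m < k)%N -> (m %/ p ^ k = 0)%N.
  by move=> mk; rewrite divn_small // (ltn_trans mk) // ltn_expl.
rewrite !logn_fact //; case: n => [|n].
  by rewrite div0n !big_nil.
rewrite big_ltn // expn1; congr addn; rewrite big_add1 /=.
set m := (n.+1 %/ p)%N.
have mn : (m <= n)%N by rewrite -ltnS ltn_Pdiv.
rewrite (@big_cat_nat _ _ _ m.+1 1) //=.
rewrite [X in (_ + X)%N]big_nat_cond [X in (_ + X)%N]big1 ?addn0.
  by apply: eq_bigr => k _; rewrite [in LHS]expnS divnMA.
by move=> k /andP[/andP[mk _] _]; rewrite expnS divnMA small.
Qed.

(** Induction through [logn_fact_quotient]: if m+1 = (n+1)/p, then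
    (p-1)(m+1) + m <= p(m+1) - 1 <= n. *)
Lemma logn_fact_le n : (p.-1 * logn p n.+1`! <= n)%N.
Proof.
have p1 := prime_gt1 p_prime.
elim/ltn_ind: n => n IHn; rewrite logn_fact_quotient.
case Em: (n.+1 %/ p)%N => [|m]; first by rewrite fact0 logn1 muln0.
have mn : (m < n)%N by rewrite -ltnS -Em ltn_Pdiv.
rewrite mulnDr -ltnS; apply: leq_trans (leq_divM n.+1 p).
rewrite Em -[p in leqRHS](prednK (prime_gt0 p_prime)) [leqRHS]mulnS.
by rewrite [leqRHS]addnC [in leqRHS]mulnC -addnS leq_add2l ltnS IHn.
Qed.

Lemma padic_abs_nat n : (0 < n)%N -> padic_abs R p n%:R = p%:R ^- logn p n.
Proof.
move=> n0; rewrite /padic_abs pnatr_eq0 gtn_eqF //.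
have -> : n%:R = n%:~R :> rat by rewrite pmulrn.
by rewrite numq_int denq_int absz_nat logn1 sub0r -exprnN.
Qed.

Variable C : padicComplex R p.

Lemma vabs_nat_Cp n : (0 < n)%N -> vabs (n%:R : C) = p%:R ^- logn p n.
Proof.
move=> n0; rewrite -padic_abs_nat //.
have [eQ _ _] := Qp_completion C; have [eC _ _] := Cp_completion C.
by rewrite -(rmorph_nat (Cp_in C)) eC -(rmorph_nat (Qpbar_in C)) Qpbar_abs
           -(rmorph_nat (Qp_in C)) eQ.
Qed.

Lemma complete_Cp : vcomplete C.
Proof. by have [] := Cp_completion C. Qed.

Lemma radius_gt0 : 0 < (p%:R : R) `^ (- (p.-1%:R)^-1).
Proof. by rewrite powR_gt0 // ltr0n prime_gt0. Qed.

Lemma radius_fact k :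
  ((p%:R : R) `^ (- (p.-1%:R)^-1)) ^+ k <= vabs (k.+1`!%:R : C).
Proof.
have p1 := prime_gt1 p_prime; set rho := _ `^ _.
have rhoX : rho ^+ p.-1 = (p%:R)^-1.
  rewrite -powR_mulrn ?powR_ge0 // -powRrM mulNr mulVf ?powR_inv1 ?ler0n //.
  by rewrite pnatr_eq0 -lt0n -subn1 subn_gt0.
have rho_le1 : rho <= 1.
  rewrite -(@expr_le1 _ p.-1) ?powR_ge0 -?lt0n -?subn1 ?subn_gt0 //.
  by rewrite subn1 rhoX invf_le1 ?ler1n ?ltr0n prime_gt0.
rewrite vabs_nat_Cp ?fact_gt0 // -exprVn -rhoX -exprM.
by rewrite ler_wiXn2l ?powR_ge0 ?logn_fact_le.
Qed.

Lemma small_nat_Cp (e : R) : 0 < e ->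
  exists2 N : nat, (0 < N)%N & vabs (N%:R : C) < e.
Proof.
move=> e0; have p1 := prime_gt1 p_prime.
have : (fun n => (p%:R^-1 : R) ^+ n) @ \oo --> (0 : R).
  by apply: cvg_expr; rewrite ger0_norm ?invr_ge0 ?ler0n //
    invf_lt1 ?ltr1n ?ltr0n ?prime_gt0.
move=> /cvgr0Pnorm_lt/(_ e e0)[n _ /(_ n (leqnn n)) /= hn].
exists (p ^ n)%N; first by rewrite expn_gt0 prime_gt0.
rewrite vabs_nat_Cp ?expn_gt0 ?prime_gt0 // pfactorK // -exprVn.
by apply: le_lt_trans hn; rewrite ler_norm.
Qed.

End PadicConstants.

(** * The algebraic identity *)

Section CarlitzAlgebra.
Variable F : fieldType.
Implicit Types (u v X e d : F) (n i l r w : nat).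

(** Coefficients of 'X^l in ((1-u) + u(1+'X))^n = (1+u'X)^n. *)
Lemma sum_binomial_binomial n l u : (l <= n)%N ->
  \sum_(i < n.+1) 'C(n, i)%:R * 'C(i, l)%:R * ((1 - u) ^+ (n - i) * u ^+ i)
  = 'C(n, l)%:R * u ^+ l.
Proof.
move=> ln.
have := exprDn (1 - u)%:P (u *: (1 + 'X)) n.
have -> : (1 - u)%:P + u *: (1 + 'X) = 1 + u *: 'X :> {poly F}.
  by rewrite scalerDr -mul_polyC mulr1 polyCB addrA subrK.
move=> /(congr1 (fun P : {poly F} => P`_l)).
have coef1D c k : (((1 : {poly F}) + c *: 'X) ^+ k)`_l = 'C(k, l)%:R * c ^+ l.
  rewrite addrC exprD1n coef_sum.
  have [lk|kl] := leqP l k.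
    rewrite (bigD1 (Ordinal (lk : (l < k.+1)%N))) //=.
    rewrite exprZn coefMn coefZ coefXn eqxx mulr1 mulr_natl big1 ?addr0 //
      => i il.
    rewrite exprZn coefMn coefZ coefXn.
    case: eqVneq => [e|_]; last by rewrite mulr0 mul0rn.
    by case/eqP: il; apply: val_inj.
  rewrite bin_small // mul0r big1 // => i _.
  rewrite exprZn coefMn coefZ coefXn gtn_eqF ?mulr0 ?mul0rn //.
  by apply: leq_trans kl; rewrite ltn_ord.
rewrite coef1D coef_sum => ->; apply: eq_bigr => i _.
rewrite coefMn -polyC_exp coefCM exprZn coefZ -['X]scale1r coef1D expr1n mulr1.
by rewrite -[RHS]mulr_natl; ring.
Qed.

(** Expanding the r-th power of the geometric sum over 0 <= j < w gives one
    monomial for each r-tuple. *)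
Lemma sum_geometric_ffun r w v : v != 1 ->
  \sum_(j : {ffun 'I_r -> 'I_w}) v ^+ (\sum_(l < r) j l)
  = ((1 - v ^+ w) / (1 - v)) ^+ r.
Proof.
move=> v1.
have -> : (1 - v ^+ w) / (1 - v) = \sum_(j < w) v ^+ j.
  apply: canLR (mulfK _) _; first by rewrite subr_eq0 eq_sym.
  by rewrite -[LHS]opprB subrX1 -mulNr opprB mulrC.
rewrite -[r in RHS]card_ord -prodr_const bigA_distr_bigA /=.
by apply: eq_bigr => j _; rewrite prodrXr.
Qed.

(** One side of the identity, with q^(w1 w2 x) abstracted to X, q^1 to e and
    1 - q to d; the right-hand side is symmetric in w1 and w2.  The powers of
    1 - e^w1 and 1 - e^w2 coming from the q-numbers cancel, the sum over i is
    [sum_binomial_binomial] and the sum over j is [sum_geometric_ffun]. *)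
Lemma carlitz_reduction e X d n r w1 w2 : d != 0 ->
  (forall k, (0 < k)%N -> e ^+ k != 1) -> (0 < w1)%N -> (0 < w2)%N ->
  \sum_(i < n.+1)
    'C(n, i)%:R * ((1 - e ^+ w1) / d) ^+ (n - i)
    * ((1 - e ^+ w2) / d) ^ (i%:Z - r%:Z)
    * (1 / (1 - e ^+ w2) ^+ i *
       \sum_(l < i.+1) 'C(i, l)%:R * (-1) ^+ l * X ^+ l
         * (l.+1%:R / ((1 - e ^+ (w2 * l.+1)) / (1 - e ^+ w2))) ^+ r)
    * (\sum_(j : {ffun 'I_r -> 'I_w2})
         ((1 - e ^+ (w1 * \sum_(l < r) j l)) / (1 - e ^+ w1)) ^+ (n - i)
         * e ^+ (w1 * (i.+1 * \sum_(l < r) j l)))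
  = d ^+ r / d ^+ n *
    \sum_(l < n.+1) 'C(n, l)%:R * (- X) ^+ l
      * (l.+1%:R * (1 - e ^+ (w1 * w2 * l.+1))
         / ((1 - e ^+ (w1 * l.+1)) * (1 - e ^+ (w2 * l.+1)))) ^+ r.
Proof.
move=> d0 he w1_gt0 w2_gt0.
have sub1_neq0 k : (0 < k)%N -> 1 - e ^+ k != 0.
  by move=> /he; rewrite subr_eq0 eq_sym.
have a0 := sub1_neq0 _ w1_gt0; have b0 := sub1_neq0 _ w2_gt0.
pose A l := (- X) ^+ l * (l.+1%:R / (1 - e ^+ (w2 * l.+1))) ^+ r.
pose u (j : {ffun 'I_r -> 'I_w2}) := e ^+ (w1 * \sum_(l < r) j l).
pose W j n i := (1 - u j) ^+ (n - i) * u j ^+ i.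
(* Cancel the q-number denominators and expand into a triple sum; the inner sum
   extends to l <= n because 'C(i, l) = 0 for l > i. *)
transitivity (d ^+ r / d ^+ n * \sum_(i < n.+1) \sum_(l < n.+1) \sum_j
    A l * u j * ('C(n, i)%:R * 'C(i, l)%:R * W j n i)).
  rewrite mulr_sumr; apply: eq_bigr => i _.
  have i_le_n : (i <= n)%N by rewrite -ltnS.
  have -> : ((1 - e ^+ w2) / d) ^ (i%:Z - r%:Z)
      = (1 - e ^+ w2) ^+ i / (1 - e ^+ w2) ^+ r * (d ^+ r / d ^+ i).
    rewrite expfzDr ?mulf_neq0 ?invr_eq0 // -exprnN -exprnP.
    by rewrite !exprMn !exprVn; field; rewrite !expf_neq0.
  have -> : \sum_(l < i.+1) 'C(i, l)%:R * (-1) ^+ l * X ^+ l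
         * (l.+1%:R / ((1 - e ^+ (w2 * l.+1)) / (1 - e ^+ w2))) ^+ r
      = (1 - e ^+ w2) ^+ r * \sum_(l < n.+1) 'C(i, l)%:R * A l.
    rewrite mulr_sumr (big_ord_widen n.+1 (fun l => 'C(i, l)%:R * (-1) ^+ l
      * X ^+ l * (l.+1%:R / ((1 - e ^+ (w2 * l.+1)) / (1 - e ^+ w2))) ^+ r)) //.
    rewrite big_mkcond; apply: eq_bigr => l _.
    case: ltnP => [_|il]; last by rewrite bin_small // mul0r mulr0.
    rewrite /A invfM invrK mulrA (exprMn r) [(- X) ^+ l]exprNn.
    by ring.
  have -> : \sum_(j : {ffun 'I_r -> 'I_w2})
         ((1 - e ^+ (w1 * \sum_(l < r) j l)) / (1 - e ^+ w1)) ^+ (n - i)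
         * e ^+ (w1 * (i.+1 * \sum_(l < r) j l))
      = (1 - e ^+ w1) ^- (n - i) * \sum_j u j * W j n i.
    rewrite mulr_sumr; apply: eq_bigr => j _.
    rewrite /W (mulnCA w1) [(i.+1 * _)%N]mulnC
            [e ^+ (_ * i.+1)]exprM -/(u j) exprS expr_div_n.
    by ring.
  rewrite exprMn exprVn.
  have -> : d ^+ n = d ^+ (n - i) * d ^+ i by rewrite -exprD subnK.
  set S1 := \sum_(l < n.+1) 'C(i, l)%:R * A l; set S2 := \sum_j u j * _.
  have -> : \sum_(l < n.+1) \sum_j
        A l * u j * ('C(n, i)%:R * 'C(i, l)%:R * W j n i)
      = 'C(n, i)%:R * (S1 * S2).
    rewrite mulr_suml mulr_sumr; apply: eq_bigr => l _.
    by rewrite !mulr_sumr; apply: eq_bigr => j _; ring.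
  by field; rewrite !expf_neq0.
(* Sum over i first, then over the tuples j. *)
congr (_ * _); rewrite exchange_big; apply: eq_bigr => l _.
have l_le_n : (l <= n)%N by rewrite -ltnS.
rewrite exchange_big /=.
transitivity ('C(n, l)%:R * A l *
    \sum_(j : {ffun 'I_r -> 'I_w2}) (e ^+ (w1 * l.+1)) ^+ (\sum_(l < r) j l)).
  rewrite mulr_sumr; apply: eq_bigr => j _.
  rewrite -mulr_sumr sum_binomial_binomial //.
  by rewrite -exprM mulnAC exprM -/(u j) exprS; ring.
rewrite sum_geometric_ffun ?he ?muln_gt0 ?w1_gt0 // -exprM mulnAC /A.
rewrite -!mulrA -exprMn; congr (_ * (_ * _ ^+ r)).
by field; rewrite !sub1_neq0 ?muln_gt0 ?w1_gt0 ?w2_gt0.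
Qed.

End CarlitzAlgebra.

(** * Evaluation of one side of the identity *)

Section Sides.
Variables (R : realType) (p : nat).
Hypothesis p_prime : prime p.
Variables (C : padicComplex R p) (q x : C).
Hypothesis q_near1 : vabs (1 - q) < (p%:R : R) `^ (- (p.-1%:R)^-1).

Let near : vabs (q - 1) < (p%:R : R) `^ (- (p.-1%:R)^-1).
Proof. by rewrite vabs_subC. Qed.

Let qpow_natE n : qpow q n%:R = qpow q 1 ^+ n :=
  qpow_nat (@complete_Cp R p C) (radius_gt0 R p_prime) (radius_fact p_prime C)
    near n.

Let qpow_natME n z : vabs z <= 1 -> qpow q (n%:R * z) = qpow q z ^+ n :=
  @qpow_natM _ _ _ (@complete_Cp R p C) (radius_gt0 R p_prime)
    (radius_fact p_prime C) _ near n z.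

Let qpow_qpowE a b : vabs a <= 1 -> qpow (qpow q a) b = qpow q (a * b) :=
  @qpow_qpow _ _ _ (@complete_Cp R p C) (radius_gt0 R p_prime)
    (radius_fact p_prime C) (small_nat_Cp p_prime C) _ near a b.

Let qpow_qpow_nat w n : qpow (qpow q w%:R) n%:R = qpow q 1 ^+ (w * n).
Proof. by rewrite qpow_qpowE ?vabs_natr_le1 // -natrM qpow_natE. Qed.

Lemma carlitz_side_eval n r w1 w2 : q <> 1 -> vabs x <= 1 ->
    (0 < w1)%N -> (0 < w2)%N ->
  \sum_(i < n.+1)
     'C(n, i)%:R * qnum q w1%:R ^+ (n - i) * qnum q w2%:R ^ (i%:Z - r%:Z) *
     carlitz_beta r i (qpow q w2%:R) (w1%:R * x) *
     carlitz_T r n i w2 (qpow q w1%:R)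
  = (1 - q) ^+ r / (1 - q) ^+ n *
    \sum_(l < n.+1) 'C(n, l)%:R * (- qpow q ((w1 * w2)%:R * x)) ^+ l
      * (l.+1%:R * (1 - qpow q 1 ^+ (w1 * w2 * l.+1))
         / ((1 - qpow q 1 ^+ (w1 * l.+1))
            * (1 - qpow q 1 ^+ (w2 * l.+1)))) ^+ r.
Proof.
move=> /eqP q1 x_le1 w1_gt0 w2_gt0.
have hx w : vabs (w%:R * x) <= 1.
  by rewrite vabsM mulr_ile1 ?vabs_ge0 ?vabs_natr_le1.
have he k : (0 < k)%N -> qpow q 1 ^+ k != 1.
  exact: (qpow_nat_neq1 (@complete_Cp R p C) (radius_gt0 R p_prime)
            (radius_fact p_prime C) (small_nat_Cp p_prime C) near q1).
have d0 : 1 - q != 0 by rewrite subr_eq0 eq_sym.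
rewrite -(carlitz_reduction _ _ _ d0 he w1_gt0 w2_gt0).
apply: eq_bigr => i _; rewrite /carlitz_beta /carlitz_T /qnum.
congr (_ * _ * _ * (_ * _) * _); rewrite ?qpow_natE //; last first.
  by apply: eq_bigr => j _; rewrite -[_ ^+ w1]qpow_natE !qpow_qpow_nat.
apply: eq_bigr => l _; rewrite -[_ ^+ w2]qpow_natE qpow_qpow_nat.
congr (_ * _ * _).
rewrite qpow_qpowE ?vabs_natr_le1 // -qpow_natME //; congr qpow.
by rewrite natrM; ring.
Qed.

End Sides.

Theorem theorem4 (R : realType) (p : nat) (p_prime : prime p)
    (C : padicComplex R p) (n r w1 w2 : nat)
    (r_gt0 : (0 < r)%N) (w1_gt0 : (0 < w1)%N) (w2_gt0 : (0 < w2)%N)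
    (q x : C) (q_neq1 : q <> 1)
    (q_near1 : vabs (1 - q) < (p%:R : R) `^ (- (p.-1%:R)^-1))
    (x_le1 : vabs x <= 1) :
  \sum_(i < n.+1)
     'C(n, i)%:R * qnum q w1%:R ^+ (n - i) * qnum q w2%:R ^ (i%:Z - r%:Z) *
     carlitz_beta r i (qpow q w2%:R) (w1%:R * x) *
     carlitz_T r n i w2 (qpow q w1%:R)
  = \sum_(i < n.+1)
     'C(n, i)%:R * qnum q w2%:R ^+ (n - i) * qnum q w1%:R ^ (i%:Z - r%:Z) *
     carlitz_beta r i (qpow q w1%:R) (w2%:R * x) *
     carlitz_T r n i w1 (qpow q w2%:R).
Proof.
rewrite !carlitz_side_eval // (mulnC w2 w1); congr (_ * _).
by apply: eq_bigr => l _; rewrite [X in _ / X]mulrC.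
Qed.
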